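(* Let $\alpha$ be a Perron number of degree $r$ with conjugates $\alpha_1=\alpha,\alpha_2,\dots,\alpha_r$, and let $G$ be the Galois group of the minimal polynomial of $\alpha$ over $\mathbb{Q}$, regarded as a permutation group on the set of conjugates $\{\alpha_1,\dots,\alpha_r\}$. If any of the following conditions is satisfied, then the module of relations $\mathcal{R}_\alpha$ is trivial, and therefore the map $\iota:\mathbb{N}_0^{r-1}\to\Omega_0$, $\kappa\mapsto s_\kappa$, is injective: (1) $\alpha$ is a Pisot number; (2) $r$ is a prime number; (3) $G$ is the symmetric group $\mathcal{S}_r$ or the alternating group $A_r$; (4) $G$ acts $2$-homogeneously on the set of conjugates $\alpha_1,\dots,\alpha_r$.
   Context: $\mathbb{N}_0=\{0,1,2,\dots\}$. A Perron number is a real algebraic integer $\alpha>1$ such that all of its other conjugates are strictly smaller than $\alpha$ in modulus. A Pisot number is a real algebraic integer greater than $1$ such that all of its other conjugates lie in the open unit disk. The degree and conjugates are taken over $\mathbb{Q}$. A permutation group acts $2$-homogeneously if it acts transitively on the set of unordered pairs of distinct points ($2$-element subsets). For a multi-index $\kappa=(\kappa_2,\dots,\kappa_r)\in\mathbb{N}_0^{r-1}$ (indexed from $2$ to $r$), put $|\kappa|=\kappa_2+\dots+\kappa_r$ and $$s_\kappa=-|\kappa|+\frac{\log|\alpha_2^{\kappa_2}\cdots\alpha_r^{\kappa_r}|}{\log\alpha}+i\,\frac{\arg(\alpha_2^{\kappa_2}\cdots\alpha_r^{\kappa_r})}{\log\alpha},$$ where $\arg$ is the principal argument with values in $(-\pi,\pi]$.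 Let $\Omega_0=\{s\in\mathbb{C} : -\frac{\pi}{\log\alpha}<\Im(s)\le\frac{\pi}{\log\alpha}\}$. The indexation map is $\iota:\mathbb{N}_0^{r-1}\to\Omega_0$, $\iota(\kappa)=s_\kappa$. The module of relations of $\alpha$ is $\mathcal{R}_\alpha=\{(m_1,\dots,m_r)\in\mathbb{Z}^r : \alpha_1^{m_1}\cdots\alpha_r^{m_r}=1\}$. It is called trivial if $\mathcal{R}_\alpha\subseteq\langle e\rangle=\mathbb{Z}e$, where $e=(1,\dots,1)\in\mathbb{Z}^r$, i.e. if every multiplicative relation between the conjugates has all exponents equal. *)

(* Defs.v *)
From mathcomp Require Import all_boot all_order all_algebra.
From mathcomp Require Import all_fingroup all_solvable all_field.
From mathcomp Require Import all_classical all_reals all_analysis.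
From mathcomp Require Export complex.

Set Implicit Arguments.
Unset Strict Implicit.
Unset Printing Implicit Defensive.

Import Order.TTheory GRing.Theory Num.Theory.
Local Open Scope ring_scope.
Local Open Scope classical_set_scope.
Local Open Scope complex_scope.

Section AlgebraicNumbers.
Variable R : realType.

(* The monic generator of the ideal of rational polynomials vanishing at [x];
   same form as [minCpolyP]. *)
Definition is_minpoly (p : {poly rat}) (x : R[i]) : Prop :=
  p \is monic /\ forall q : {poly rat}, root (map_poly ratr q) x = (p %| q).

Definition conjugate (x y : R[i]) : Prop :=
  exists2 p : {poly rat}, is_minpoly p x & root (map_poly ratr p) y.

Definition algebraic_integer (x : R) : Prop :=
  integralOver (intr : int -> R) x.

Definition perron (alpha : R) : Prop :=
  [/\ algebraic_integer alpha, 1 < alpha &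
      forall y, conjugate alpha%:C y -> y != alpha%:C ->
        Normc.normc y < alpha].

Definition pisot (alpha : R) : Prop :=
  [/\ algebraic_integer alpha, 1 < alpha &
      forall y, conjugate alpha%:C y -> y != alpha%:C ->
        Normc.normc y < 1].

(* [a] lists the conjugates of [alpha], starting with [alpha]; [p] is its
   minimal polynomial.  As [p] is separable, [a] has no repetition and the
   degree of [alpha] is [n.+1]. *)
Definition conjugates_of (alpha : R) (p : {poly rat}) (n : nat)
    (a : 'I_n.+1 -> R[i]) : Prop :=
  [/\ is_minpoly p alpha%:C,
      map_poly ratr p = \prod_(i < n.+1) ('X - (a i)%:P) &
      a ord0 = alpha%:C].

(* The Galois group of [p] as a group of permutations of the indices of the
   roots [a i]: the permutations induced by the automorphisms of a splitting
   field [L] of [p], embedded in [R[i]] by [phi].  The set does not depend on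
   [L] and [phi], since all these embeddings have the same image. *)
Definition galois_perms (p : {poly rat}) (n : nat) (a : 'I_n.+1 -> R[i]) :
    {set 'S_n.+1} :=
  finset (fun s : 'S_n.+1 => `[<
    exists (L : splittingFieldType rat) (phi : {rmorphism L -> R[i]})
           (b : 'I_n.+1 -> L),
      [/\ splittingFieldFor 1 (map_poly (in_alg L) p) {:L},
          forall i, phi (b i) = a i &
          exists2 g, g \in 'Gal({:L} / 1)%g & forall i, g (b i) = b (s i)] >]).

End AlgebraicNumbers.

Definition two_homogeneous (n : nat) (G : {set 'S_n}) : Prop :=
  forall A B : {set 'I_n}, #|A| = 2%N -> #|B| = 2%N ->
    exists2 s : 'S_n, s \in G & [set s x | x in A]%SET = B.

Section Relations.
Variables (R : realType) (n : nat) (a : 'I_n.+1 -> R[i]).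

Definition relation_module : set 'rV[int]_n.+1 :=
  [set m : 'rV[int]_n.+1 | \prod_(i < n.+1) (a i) ^ (m ord0 i) = 1].

Definition trivial_relations : Prop :=
  relation_module `<=` range (fun c : int => c *: (const_mx 1 : 'rV[int]_n.+1)).

End Relations.

Section Indexation.
Variable R : realType.

(* Principal argument; only meaningful for [z != 0]. *)
Definition arg (z : R[i]) : R :=
  xget 0 [set t : R | - pi < t <= pi /\
                      z = (Normc.normc z)%:C * (cos t +i* sin t)].

Definition Omega0 (alpha : R) : set R[i] :=
  [set s | - (pi / ln alpha) < complex.Im s <= pi / ln alpha].

(* [kappa j] is the exponent of the conjugate [a (lift ord0 j)], so that
   [j = 0, .., n - 1] stands for the indices [2, .., r] with [r = n.+1]. *)
Definition iota_map (alpha : R) (n : nat) (a : 'I_n.+1 -> R[i])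
    (kappa : {ffun 'I_n -> nat}) : R[i] :=
  let z := \prod_(j < n) a (lift ord0 j) ^+ kappa j in
  (- (\sum_(j < n) kappa j)%:R + ln (Normc.normc z) / ln alpha)
    +i* (arg z / ln alpha).

End Indexation.

(* Main.v *)
Require Import Defs.
From mathcomp Require Import all_boot all_order all_algebra.
From mathcomp Require Import all_fingroup all_solvable all_field.
From mathcomp Require Import all_classical all_reals all_analysis.
From mathcomp Require Import lra ring.

Set Implicit Arguments.
Unset Strict Implicit.
Unset Printing Implicit Defensive.

Import Order.TTheory GRing.Theory Num.Theory.
Local Open Scope ring_scope.
Local Open Scope complex_scope.

(* Put [l i = ln |a i|].  The permutations of the conjugates preserving all
   multiplicative relations form a group [H]; it contains the Galois group and
   it is transitive, so a relation [m] gives [\sum_i m i * l (s i) = 0] for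
   every [s] in [H], while [l] has a strict maximum at [alpha].
   - Pisot: [l < 0] at the other conjugates, and [\sum_i l i >= 0] since the
     norm is a nonzero integer.  Moving to [alpha] an index where [m] is
     maximal forces [max m < 0], and likewise [min m > 0], unless [m] is
     constant.
   - Prime degree: [H] contains an [r]-cycle, so that [m] and [l] have a zero
     convolution over Z/r; as [1 + 'X + ... + 'X^(r-1)] is irreducible, either
     [m] or [l] is constant.
   - 2-homogeneous (which includes the alternating and symmetric groups):
     averaging the square of the relation over [H] gives a definite quadratic
     form in the part of [m] of zero sum.
   Finally [s_kappa] determines [\prod_j (a j / alpha) ^ kappa j], so two
   indices with the same image differ by a relation whose exponents have zero
   sum. *)

(** * Irreducible polynomials and their roots in an extension field *)

Section IrreduciblePolynomials.
Variables (F L : fieldType) (iota : {rmorphism F -> L}).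
Implicit Types (p q f : {poly F}) (x z : L).

(** If [p] does not divide [q], the two are coprime and share no root. Hence all roots of [p]
    annihilate the same polynomials over [F], which is what moves relations between conjugates. *)
Lemma irreducible_root_dvdp p x : irreducible_poly p ->
  root (map_poly iota p) x ->
  forall q, root (map_poly iota q) x = (p %| q).
Proof.
move=> irr_p px q; apply/idP/idP=> [qx|/dvdpP[r ->]]; last first.
  by rewrite rmorphM rootM px orbT.
apply: contraLR qx; rewrite -irreducible_poly_coprime // -(coprimep_map iota).
by move=> /coprimep_root/(_ px); rewrite /root.
Qed.

Lemma minpoly_irreducible p x : p != 0 ->
  (forall q, root (map_poly iota q) x = (p %| q)) -> irreducible_poly p.
Proof.
move=> nz_p dv_p; have px : root (map_poly iota p) x by rewrite dv_p.
by apply/(subfx_irreducibleP px nz_p) => q qx nz_q; rewrite dvdp_leq // -dv_p.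
Qed.

Lemma algebraic_irreducible x : algebraicOver iota x ->
  exists2 p, irreducible_poly p & root (map_poly iota p) x.
Proof.
case=> p; have [m] := ubnP (size p); elim: m p => // m IHm p lt_pm nz_p px.
have [[q [qx nz_q lt_qp]]|min_p] := pselect
    (exists q, [/\ root (map_poly iota q) x, q != 0 & (size q < size p)%N]).
  exact: IHm q (leq_trans lt_qp lt_pm) nz_q qx.
exists p => //; apply/(subfx_irreducibleP px nz_p) => q qx nz_q.
by rewrite leqNgt; apply/negP=> lt_qp; apply: min_p; exists q.
Qed.

End IrreduciblePolynomials.

(** * Lifting a conjugate of a value to a conjugate of the argument *)

Section RootLift.
Variables (F : fieldType) (C : closedFieldType) (iota : {rmorphism F -> C}).
Implicit Types (p q f : {poly F}) (c z : C).
Local Notation "p ^e" := (map_poly iota p) (at level 2, format "p ^e").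

(* The resultant of [q(X)] and [f(X) - Y] is a polynomial in [Y] over [F]
   whose roots are the values of [f] at the roots of [q]. *)
Lemma root_lift p q f z c : irreducible_poly p -> q != 0 ->
    root q^e z -> root p^e f^e.[z] -> root p^e c ->
  exists2 z', root q^e z' & f^e.[z'] = c.
Proof.
move=> irr_p nz_q qz pfz pc.
(* The leading coefficient of [fY] has to come from [f]; adding [q] to a constant [f] ensures this
   and keeps its values at the roots of [q]. *)
wlog sz_f : f pfz / (1 < size f)%N.
  move=> IH; have [/IH|sz_f] := ltnP 1 (size f); first exact.
  have sz_q : (1 < size q)%N.
    by rewrite -(size_map_poly iota) (root_size_gt1 _ qz) ?map_poly_eq0.
  have sz_fq : size (f + q) = size q.
    by rewrite addrC size_polyDl // (leq_ltn_trans sz_f).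
  have valE w : root q^e w -> (f + q)^e.[w] = f^e.[w].
    by move=> /rootP qw; rewrite rmorphD hornerD qw addr0.
  have [] := IH (f + q); rewrite ?valE ?sz_fq // => w qw.
  by rewrite valE // => <-; exists w.
pose ev (d : C) : {rmorphism {poly F} -> C} := horner_eval d \o map_poly iota.
(* The outer variable is X; Y is the inner one, embedded as [('X)%:P]. *)
pose fY : {poly {poly F}} := map_poly polyC f - ('X)%:P.
pose r := resultant (map_poly polyC q) fY.
have lead_fY : lead_coef fY = (lead_coef f)%:P.
  rewrite lead_coefDl; last first.
    by rewrite size_polyN size_polyC polyX_eq0 size_map_polyC.
  by rewrite lead_coef_map_id0 ?polyC0 ?polyC_eq0 ?lead_coef_eq0 // -size_poly_gt0 ltnW.
have evC d : ev d \o polyC =1 iota.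
  by move=> t; rewrite /= /horner_eval map_polyC hornerC.
have nz_f : f != 0 by rewrite -size_poly_gt0 ltnW.
have ev_r d : root r^e d = (1 < size (gcdp q^e (f^e - d%:P)))%N.
  have -> : root r^e d = (ev d r == 0) by [].
  rewrite /r map_resultant ?resultant_eq0; last 2 first.
  - rewrite lead_coef_map_id0 ?polyC0 ?polyC_eq0 ?lead_coef_eq0 //.
    by rewrite -[ev d _]/((ev d \o polyC) _) evC fmorph_eq0 lead_coef_eq0.
  - by rewrite lead_fY -[ev d _]/((ev d \o polyC) _) evC fmorph_eq0 lead_coef_eq0.
  have mapE g : map_poly (ev d) (map_poly polyC g) = map_poly iota g.
    by rewrite -map_poly_comp (eq_map_poly (evC d)).
  have -> : map_poly (ev d) fY = f^e - d%:P; last by rewrite mapE.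
  rewrite -[f^e]mapE [LHS]rmorphB; congr (_ - _).
  by rewrite [LHS]map_polyC /= /horner_eval map_polyX hornerX.
have rz : root r^e f^e.[z].
  rewrite ev_r; apply: (@root_size_gt1 _ z).
    by rewrite gcdp_eq0 map_poly_eq0 (negPf nz_q).
  by rewrite root_gcd qz rootE !hornerE subrr eqxx.
have : root r^e c.
  move: rz; rewrite (irreducible_root_dvdp irr_p pfz).
  by rewrite -(irreducible_root_dvdp irr_p pc).
rewrite ev_r => sz_g.
have /closed_rootP[w] : size (gcdp q^e (f^e - c%:P)) != 1 by rewrite gtn_eqF.
rewrite root_gcd => /andP[qw]; rewrite rootE !hornerE subr_eq0 => /eqP.
by exists w.
Qed.

End RootLift.

(** * Conjugates over the rationals *)

Section Conjugates.
Variables (C : closedFieldType) (iota : {rmorphism rat -> C}).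
Implicit Types (p q f : {poly rat}) (c z : C).
Local Notation "p ^e" := (map_poly iota p) (at level 2, format "p ^e").

(** By induction: in characteristic zero the new element and the previous generator are both
    polynomials in some [z *+ k - x], and composition rewrites the earlier elements. *)
Lemma primitive_element (s : seq C) : {in s, forall x, algebraicOver iota x} ->
  exists2 z, algebraicOver iota z &
    exists ps : seq {poly rat}, s = [seq p^e.[z] | p <- ps].
Proof.
elim: s => [|x s IHs] alg_s.
  by exists 0; [exact: algebraic0 | exists [::]].
have [|z alg_z [ps ->]] := IHs; first by move=> y ys; apply: alg_s; rewrite inE ys orbT.
have alg_x : algebraicOver iota x by apply: alg_s; rewrite mem_head.
have [p nz_p px] := alg_x; have [q nz_q qz] := alg_z.
have [k [[px' Dx] [pz Dz]]] := pchar0_PET nz_p px nz_q qz (pchar_num _).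
exists (z *+ k - x).
  apply: algebraic_sub => //; rewrite -mulr_natr.
  apply: algebraic_mul => //; rewrite -(rmorph_nat iota); exact: algebraic_id.
exists (px' :: [seq f \Po pz | f <- ps]); rewrite /= Dx -map_comp; congr (_ :: _).
by apply: eq_map => f; rewrite /= map_comp_poly horner_comp Dz.
Qed.

(** In characteristic zero the derivative is nonzero and of smaller size, so [p] cannot divide
    it. *)
Lemma separable_irreducible p : irreducible_poly p -> separable_poly p.
Proof.
move=> irr_p; have [sz_p _] := irr_p.
rewrite separable_poly.unlock irreducible_poly_coprime //; apply/negP=> dv_p.
have nz_p : p != 0 by rewrite -size_poly_gt0 ltnW.
have p'0 : p^`() = 0.
  by apply: contraTeq (lt_size_deriv nz_p) => nz_p'; rewrite -leqNgt dvdp_leq.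
have := congr1 (coefp (size p).-2) p'0; rewrite /= coef0 coef_deriv.
have -> : ((size p).-2.+1 = (size p).-1)%N by case: (size p) sz_p => [|[]].
move=> /eqP; rewrite mulrn_eq0 -lead_coefE lead_coef_eq0 (negPf nz_p) orbF.
by case: (size p) sz_p => [|[]].
Qed.

Variables (n : nat) (a : 'I_n.+1 -> C) (p : {poly rat}).
Hypotheses (irr_p : irreducible_poly p)
  (Dp : p^e = \prod_(i < n.+1) ('X - (a i)%:P)).

Lemma conj_rootP c : reflect (exists i, c = a i) (root p^e c).
Proof.
rewrite Dp -(big_map a xpredT (fun x => 'X - x%:P)) root_prod_XsubC.
by apply: (iffP mapP) => [[i _ ->]|[i ->]]; exists i; rewrite ?mem_index_enum.
Qed.

Lemma conj_root i : root p^e (a i). Proof. by apply/conj_rootP; exists i. Qed.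

Lemma conj_inj : injective a.
Proof.
have := separable_irreducible irr_p; rewrite -(separable_map iota) Dp.
rewrite -big_enum -(big_map a xpredT (fun x => 'X - x%:P)) separable_prod_XsubC.
by move=> /injectiveP.
Qed.

Lemma conj_neq0 i j : a i != 0 -> a j != 0.
Proof.
apply: contra_neq => aj0.
have : root (map_poly iota 'X) (a j) by rewrite map_polyX rootX aj0.
rewrite (irreducible_root_dvdp irr_p (conj_root j)).
by rewrite -(irreducible_root_dvdp irr_p (conj_root i)) map_polyX rootX => /eqP.
Qed.

Definition int_pos_part (m : int) : nat := if m is Posz k then k else 0%N.
Definition int_neg_part (m : int) : nat := int_pos_part (- m).

(** Separating the signs of the exponents makes a relation a polynomial identity, which can be
    transferred from one root to another. *)
Lemma prod_exprz_eq1 (x : 'I_n.+1 -> C) (m : 'I_n.+1 -> int) :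
    (forall i, x i != 0) ->
  (\prod_i x i ^ m i == 1) =
    (\prod_i x i ^+ int_pos_part (m i) == \prod_i x i ^+ int_neg_part (m i)).
Proof.
move=> nz_x; have exprzE y k : y != 0 ->
    y ^ k = y ^+ int_pos_part k / y ^+ int_neg_part k :> C.
  move=> nz_y; case: k => k; first by case: k => [|k]; rewrite /= ?divr1 ?invr1 ?mulr1.
  by rewrite /= mul1r.
rewrite (eq_bigr (fun i => x i ^+ int_pos_part (m i) / x i ^+ int_neg_part (m i))).
  have nz_d : \prod_i x i ^+ int_neg_part (m i) != 0.
    by apply/prodf_neq0 => i _; rewrite expf_neq0.
  by rewrite prodf_div -[X in _ == X](divff nz_d) (inj_eq (mulIf _)) ?invr_neq0.
by move=> i _; apply: exprzE.
Qed.

(* Writing [a i = f i (z)] for a primitive element [z], any other root [z'] of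
   the minimal polynomial of [z] gives such a permutation,
   [f i (z') = a (s i)]. *)
Lemma conj_perm j : a ord0 != 0 ->
  exists2 s : 'S_n.+1, s ord0 = j &
    forall m : 'I_n.+1 -> int, \prod_i a i ^ m i = 1 -> \prod_i a (s i) ^ m i = 1.
Proof.
move=> nz_a0; have nz_a i : a i != 0 by apply: conj_neq0 nz_a0.
have nz_p : p != 0 by have [sz_p _] := irr_p; rewrite -size_poly_gt0 ltnW.
have [|z alg_z [ps Dps]] := @primitive_element (mkseq (fun k => a (inord k)) n.+1).
  by move=> _ /mapP[k _ ->]; exists p; rewrite ?conj_root.
pose f (i : 'I_n.+1) := ps`_i.
have Da i : a i = (f i)^e.[z].
  have szE : size ps = n.+1 by rewrite -(size_mkseq (a \o inord) n.+1) Dps size_map.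
  by rewrite -(nth_map 0 0 (fun g => g^e.[z])) ?szE // -Dps nth_mkseq // inord_val.
have [q irr_q qz] := algebraic_irreducible alg_z.
have nz_q : q != 0 by have [sz_q _] := irr_q; rewrite -size_poly_gt0 ltnW.
have [|z' qz' Daj] :=
  root_lift irr_p nz_q qz (_ : root p^e (f ord0)^e.[z]) (conj_root j).
  by rewrite -Da conj_root.
(* [q] is irreducible, so [z] and [z'] annihilate the same rational polynomials. *)
have transfer g : (g^e.[z'] == 0) = (g^e.[z] == 0).
  by rewrite -!rootE (irreducible_root_dvdp irr_q qz') (irreducible_root_dvdp irr_q qz).
have /fin_all_exists[s Ds] i : exists k, (f i)^e.[z'] = a k.
  apply/conj_rootP; rewrite rootE -horner_comp -map_comp_poly transfer.
  by rewrite map_comp_poly horner_comp -Da -rootE conj_root.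
have inj_s : injective s.
  move=> i k eq_s; apply: conj_inj; apply/eqP; rewrite !Da -subr_eq0.
  rewrite -hornerN -hornerD -rmorphB -transfer rmorphB hornerD hornerN.
  by rewrite !Ds eq_s subrr.
exists (perm inj_s); first by rewrite permE; apply: conj_inj; rewrite -Ds.
move=> m /eqP; rewrite prod_exprz_eq1 // => rel; apply/eqP.
rewrite prod_exprz_eq1 // -subr_eq0.
pose g := \prod_i f i ^+ int_pos_part (m i) - \prod_i f i ^+ int_neg_part (m i).
have gE w : g^e.[w] = \prod_i (f i)^e.[w] ^+ int_pos_part (m i)
    - \prod_i (f i)^e.[w] ^+ int_neg_part (m i).
  rewrite rmorphB !rmorph_prod hornerD hornerN !horner_prod.
  by congr (_ - _); apply: eq_bigr => i _; rewrite rmorphXn horner_exp.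
move: rel; rewrite -subr_eq0.
under eq_bigr do rewrite Da; under [X in _ - X]eq_bigr do rewrite Da.
rewrite -gE -transfer gE.
by under eq_bigr do rewrite Ds -(permE inj_s);
   under [X in _ - X]eq_bigr do rewrite Ds -(permE inj_s).
Qed.

End Conjugates.

(** * Real linear relations under a transitive permutation group *)

Section LinearRelations.
Variables (R : realFieldType) (n : nat) (l : 'I_n.+1 -> R) (H : {group 'S_n.+1}).
Implicit Types (m : 'I_n.+1 -> int) (i j k : 'I_n.+1).

Definition orbit_relation m :=
  forall s, s \in H -> \sum_i (m i)%:~R * l (s i) = 0.

Hypothesis H_trans : forall j, exists2 s, s \in H & s ord0 = j.

Lemma H_transP i j : exists2 s, s \in H & s i = j.
Proof.
have [[s Hs <-] [t Ht <-]] := (H_trans i, H_trans j).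
by exists (s^-1 * t)%g; rewrite ?groupM ?groupV // permM permK.
Qed.

Lemma sum_orbit i j (f : R -> R) :
  \sum_(s in H) f (l (s i)) = \sum_(s in H) f (l (s j)).
Proof.
have [t Ht <-] := H_transP i j.
rewrite [LHS](reindex_inj (mulgI t)) /=.
by apply: eq_big => [s|s _]; rewrite ?groupMl // permM.
Qed.

Section DominantTerm.
Hypotheses (l_lt0 : forall j, j != ord0 -> l j < 0)
  (sum_l_ge0 : 0 <= \sum_i l i).

(** Take [s] in [H] with [s k = ord0] and subtract the relation from [m k] times the sum of [l]. The
    coefficient [m k - m j] vanishes at [j = k], the only index where [l (s j)] may be nonnegative;
    the other terms are nonpositive, and that of [i] is negative. *)
Lemma max_coef_lt0 m i k : orbit_relation m ->
  (forall j, m j <= m k) -> m i < m k -> m k < 0.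
Proof.
move=> rel max_k lt_ik; have [s Hs sk] := H_transP k ord0.
have l_le0 j : (m k - m j)%:~R * l (s j) <= 0.
  have [->|ne_jk] := eqVneq j k; first by rewrite subrr mul0r.
  rewrite mulr_ge0_le0 ?ler0z ?subr_ge0 // ltW // l_lt0 //.
  by rewrite -sk (inj_eq perm_inj).
have l_i : (m k - m i)%:~R * l (s i) < 0.
  rewrite pmulr_rlt0 ?ltr0z ?subr_gt0 // l_lt0 // -sk (inj_eq perm_inj).
  by apply: contraTneq lt_ik => ->; rewrite ltxx.
have : (m k)%:~R * \sum_j l j < 0.
  have -> : (m k)%:~R * \sum_j l j = \sum_j (m k - m j)%:~R * l (s j).
    under [RHS]eq_bigr do rewrite rmorphB mulrBl.
    rewrite sumrB rel // subr0 -mulr_sumr; congr (_ * _).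
    by rewrite [LHS](reindex_inj (@perm_inj _ s)).
  rewrite (bigD1 i) //= -[ltRHS]addr0 ltr_leD // sumr_le0 //.
by rewrite -(ltrz0 R); apply: contraTT; rewrite -!leNgt => mk; rewrite mulr_ge0.
Qed.

(** Otherwise the bound applied to [m] and to its opposite makes the maximum negative and the
    minimum positive. *)
Lemma dominant_relation_const m i : orbit_relation m -> m i = m ord0.
Proof.
move=> rel; have rel' : orbit_relation (fun j => - m j).
  move=> s /rel rel_s; under eq_bigr do rewrite rmorphN mulNr.
  by rewrite sumrN rel_s oppr0.
pose k := [arg max_(k > ord0) m k]%O; pose k' := [arg min_(k < ord0) m k]%O.
have max_k j : m j <= m k by rewrite /k; case: arg_maxP => // x _; apply.
have min_k j : m k' <= m j by rewrite /k'; case: arg_minP => // x _; apply.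
have [eq_k|ne_k] := eqVneq (m k) (m k').
  have m_k j : m j = m k by apply/eqP; rewrite eq_le max_k eq_k min_k.
  by rewrite !m_k.
have lt_k : m k' < m k by rewrite lt_neqAle eq_sym ne_k min_k.
have mk_lt0 := max_coef_lt0 rel max_k lt_k.
have := @max_coef_lt0 (fun j => - m j) k k' rel'.
rewrite oppr_lt0 ltrN2 => /(_ _ lt_k) k'_gt0.
have /k'_gt0 : forall j, - m j <= - m k' by move=> j; rewrite lerN2.
by move=> /(lt_trans mk_lt0)/lt_trans/(_ lt_k); rewrite ltxx.
Qed.

End DominantTerm.

Section TwoHomogeneous.
Hypothesis H_hom : forall i j i' j', i != j -> i' != j' ->
  exists2 s, s \in H & (s i = i' /\ s j = j') \/ (s i = j' /\ s j = i').

Let D i j := \sum_(s in H) (l (s i) - l (s j)) ^+ 2.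

(* The average of [l (s i) * l (s j)] over [H] takes one value on the diagonal
   and another one off it, so that on vectors of zero sum the average of
   [(\sum_i m i * l (s i))^2] is a multiple of the standard quadratic form. *)
Lemma two_homogeneous_relation_const m i0 i : l i0 != l ord0 ->
  orbit_relation m -> m i = m ord0.
Proof.
move=> ne_l rel.
(* [D] is symmetric, so transitivity on unordered pairs is enough. *)
have DE i1 j1 i2 j2 : i1 != j1 -> i2 != j2 -> D i1 j1 = D i2 j2.
  move=> ne_1 ne_2; have [t Ht ts] := H_hom ne_1 ne_2.
  rewrite /D [RHS](reindex_inj (mulgI t^-1%g)) /=.
  apply: eq_big => [s|s _]; first by rewrite groupMl ?groupV.
  by case: ts => -[<- <-]; rewrite !permM !permK // -sqrrN opprB.
have ne_i0 : i0 != ord0 by apply: contraNneq ne_l => ->.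
pose d := D i0 ord0.
have d_gt0 : 0 < d.
  rewrite /d /D (bigD1 1%g) //= !perm1 ltr_pwDl //.
    by rewrite exprn_even_gt0 //= subr_eq0.
  by apply: sumr_ge0 => s _; rewrite sqr_ge0.
pose N : R := n.+1%:R; pose M : R := \sum_j (m j)%:~R.
(* The zero-sum part of [m], scaled by [N] to avoid a division. *)
pose x j : R := N * (m j)%:~R - M.
have sum_x : \sum_j x j = 0.
  by rewrite sumrB -mulr_sumr sumr_const card_ord -mulr_natl subrr.
pose S := \sum_j l j.
have rel_x s : s \in H -> \sum_j x j * l (s j) = - (M * S).
  move=> Hs; under eq_bigr do rewrite mulrBl -mulrA.
  rewrite sumrB -!mulr_sumr rel // mulr0 sub0r; congr (- (_ * _)).
  by rewrite /S [RHS](reindex_inj (@perm_inj _ s)).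
(* This value is the same for all [s], while its sum over [H] is a multiple of [\sum_j x j]. *)
have MS0 : - (M * S) = 0.
  have : \sum_(s in H) - (M * S) = 0.
    rewrite -(eq_bigr _ rel_x) exchange_big /=.
    under eq_bigr => j _ do rewrite -mulr_sumr (sum_orbit j ord0 id).
    by rewrite -mulr_suml sum_x mul0r.
  rewrite sumr_const => /eqP; rewrite mulrn_eq0 => /orP[|/eqP] //.
  by rewrite gtn_eqF ?cardG_gt0.
(* As [x] has zero sum, the double sum is -2 times the square of [\sum_j x j * l (s j)]. *)
have sq s : s \in H -> \sum_i \sum_j x i * x j * (l (s i) - l (s j)) ^+ 2 = 0.
  move=> Hs; have xl := rel_x s Hs; rewrite MS0 in xl.
  transitivity (\sum_i (x i * l (s i) ^+ 2 * (\sum_j x j)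
     + (x i * (\sum_j x j * l (s j) ^+ 2)) 
     - 2 * (x i * l (s i)) * \sum_j x j * l (s j))).
    apply: eq_bigr => i1 _; rewrite !mulr_sumr -big_split /= -sumrB.
    by apply: eq_bigr => j _; ring.
  rewrite sum_x xl; under eq_bigr do rewrite !mulr0 add0r subr0.
  by rewrite -mulr_suml sum_x mul0r.
(* Summed over [H], each off-diagonal square gives [d], so the total is [d] times the off-diagonal
   sum of [x i * x j], that is [- d * \sum_i x i ^+ 2]. *)
have x2 : d * \sum_i x i ^+ 2 = 0.
  have : \sum_(s in H) \sum_i \sum_j x i * x j * (l (s i) - l (s j)) ^+ 2 = 0.
    exact: big1.
  rewrite exchange_big /=; under eq_bigr do rewrite exchange_big /=.
  rewrite (eq_bigr (fun i => - (d * x i ^+ 2))).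
    by rewrite sumrN -mulr_sumr => /eqP; rewrite oppr_eq0 => /eqP.
  move=> i1 _; have : \sum_j x i1 * x j * d = 0.
    by rewrite -mulr_suml -mulr_sumr sum_x mulr0 mul0r.
  rewrite (bigD1 i1) //= => /eqP; rewrite addrC addr_eq0 => /eqP eq_d.
  rewrite (bigD1 i1) //= big1 ?add0r; last first.
    by move=> s _; rewrite subrr expr0n mulr0.
  rewrite [d * _]mulrC expr2.
  rewrite -eq_d; apply: eq_bigr => j ne_j; rewrite -mulr_sumr; congr (_ * _).
  by apply: DE => //; rewrite eq_sym.
have x0 j : x j = 0.
  move/eqP: x2; rewrite mulf_eq0 gt_eqF //= psumr_eq0 => [/allP/(_ j)|? _].
  2: exact: sqr_ge0.
  by rewrite mem_index_enum sqrf_eq0 => /(_ isT)/eqP.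
have NM j : N * (m j)%:~R = M by apply/eqP; rewrite -subr_eq0 -/(x j) x0.
apply: (@intr_inj R); apply: (@mulfI _ N); first by rewrite pnatr_eq0.
by rewrite !NM.
Qed.

End TwoHomogeneous.

End LinearRelations.

(** * Relations in prime degree *)

(** It vanishes at a primitive [p]-th root of unity and has the size of the cyclotomic polynomial,
    which is the minimal polynomial there. *)
Lemma irreducible_geometric_sum p : prime p ->
  irreducible_poly (\sum_(k < p) 'X^k : {poly rat}).
Proof.
move=> pr_p; have p_gt0 := prime_gt0 pr_p.
set P := \sum_(k < p) _.
have PE : P = \poly_(k < p) 1.
  by rewrite poly_def; apply: eq_bigr => k _; rewrite scale1r.
have sz_P : size P = p by rewrite PE size_poly_eq // oner_neq0.
have [z prim_z] := C_prim_root_exists p_gt0.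
have [q [Dq mon_q] dv_q] := minCpolyP z.
have sz_q : size q = p.
  rewrite -(size_map_poly (ratr : rat -> algC)) -Dq (minCpoly_cyclotomic prim_z).
  by rewrite size_cyclotomic totient_prime // prednK.
have Pz : root (map_poly ratr P) z.
  have z_neq1 : z - 1 != 0.
    rewrite subr_eq0; apply/eqP=> z1; have := prim_order_dvd prim_z 1.
    by rewrite z1 expr1n eqxx dvdn1 => /eqP p1; rewrite p1 in pr_p.
  rewrite rootE rmorph_sum /= horner_sum -(mulrI_eq0 _ (lregP z_neq1)).
  under eq_bigr do rewrite map_polyXn hornerXn.
  by rewrite -subrX1 prim_expr_order // subrr.
have eq_qP : q %= P by rewrite -dvdp_size_eqp ?sz_q ?sz_P // -dv_q.
have irr_q := minpoly_irreducible (monic_neq0 mon_q) dv_q.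
have [sz irr] := irr_q; split; first by rewrite sz_P -sz_q.
by move=> r sz_r; rewrite -(eqp_dvdr _ eq_qP) => /(irr r sz_r)/eqp_trans; apply.
Qed.

Section PrimeDegree.
Variables (R : realFieldType) (n : nat) (H : {group 'S_n.+1}).
Hypotheses (pr_n : prime n.+1)
  (H_trans : forall j, exists2 s, s \in H & s ord0 = j).

(** By transitivity [n.+1] divides [#|H|], and Cauchy's theorem gives an element of order [n.+1].
    The orbit of a point that it moves has [n.+1] elements, hence is everything. *)
Lemma full_cycle : exists2 s, s \in H &
  forall i : 'I_n.+1, injective (fun k : 'I_n.+1 => (s ^+ k)%g i).
Proof.
have dv_H : (n.+1 %| #|H|)%N.
  have trH : [transitive H, on [set: 'I_n.+1] | 'P].
    apply/imsetP; exists ord0; rewrite ?inE //; apply/esym/eqP; rewrite -finset.subTset.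
    apply/fintype.subsetP=> j _; have [s Hs <-] := H_trans j.
    by apply/orbitP; exists s.
  by have := atrans_dvd trH; rewrite cardsT card_ord.
have [s Hs ord_s] := Cauchy pr_n dv_H.
have fixX (t : 'S_n.+1) i d : t i = i -> (t ^+ d)%g i = i.
  by move=> ti; elim: d => [|d IHd]; rewrite ?perm1 // expgS permM ti.
(* The order is prime, so [s ^+ d] generates the same cyclic group as [s]. *)
have fix_s i d : (0 < d < n.+1)%N -> (s ^+ d)%g i = i -> s i = i.
  move=> /andP[d_gt0 lt_dn] si.
  have /cycleP[u ->] : s \in <[s ^+ d]>%g.
    suff /eqP <- : generator <[s]>%g (s ^+ d)%g by apply: cycle_id.
    by rewrite generator_coprime ord_s prime_coprime // gtnNdvd.
  exact: fixX.
have inj_s i : s i != i -> injective (fun k : 'I_n.+1 => (s ^+ k)%g i).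
  move=> ne_i k k'; wlog lt_kk' : k k' / (k < k')%N.
    by move=> IH; case: (ltngtP k k') => [/IH|/IH IH' /esym/IH'/esym|/val_inj].
  move=> eq_s; case/eqP: ne_i; apply: (@fix_s _ (k' - k)%N).
    by rewrite subn_gt0 lt_kk' (leq_ltn_trans (leq_subr _ _)).
  apply: (@perm_inj _ (s ^+ k)%g); rewrite -permM -expgD subnK 1?ltnW //.
have [i0 ne_i0] : exists i, s i != i.
  apply/existsP; apply: contraTT pr_n; rewrite negb_exists => /forallP fix_all.
  have s1 : s = 1%g.
    by apply/permP=> i; rewrite perm1; apply/eqP; have := fix_all i; rewrite negbK.
  by rewrite -ord_s s1 order1.
exists s => // i; apply: (inj_s i); apply/eqP=> si.
have [g _ gi] := injF_bij (inj_s i0 ne_i0).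
move/eqP: ne_i0; apply; apply: (@perm_inj _ (s ^+ g i)%g).
by rewrite -permM -expgS expgSr permM [(s ^+ g i)%g i0]gi.
Qed.

Lemma horner_perm_mx (s : 'S_n.+1) (P : {poly R}) (v : 'cV[R]_n.+1) i :
  (horner_mx (perm_mx s) P *m v) i ord0 =
    \sum_(k < size P) P`_k * v ((s ^+ k)%g i) ord0.
Proof.
rewrite -[in LHS](coefK P) poly_def rmorph_sum mulmx_suml summxE.
apply: eq_bigr => k _.
rewrite -mul_polyC rmorphM /= horner_mx_C -mulmxE mul_scalar_mx -scalemxAl mxE.
congr (_ * _).
rewrite rmorphXn /= horner_mx_X.
elim: (nat_of_ord k) i => [|d IHd] i; first by rewrite expr0 mul1mx perm1.
by rewrite exprS -mulmxE -mulmxA -row_permE mxE IHd expgS permM.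
Qed.

(* The matrix of an [n.+1]-cycle makes column vectors a module over [R['X]]:
   a relation becomes a rational polynomial of degree at most [n] annihilating
   [l].  Either it is a multiple of [1 + 'X + ... + 'X^n], or it is coprime to
   it and [l] is a multiple of the image of [l] by that polynomial, which is a
   constant vector. *)
Lemma prime_relation_const (l : 'I_n.+1 -> R) (m : 'I_n.+1 -> int) i0 i :
  l i0 != l ord0 -> orbit_relation l H m -> m i = m ord0.
Proof.
move=> ne_l rel; have [s Hs inj_s] := full_cycle.
have sum_s (f : 'I_n.+1 -> R) j : \sum_(k < n.+1) f ((s ^+ k)%g j) = \sum_k f k.
  by rewrite [RHS](reindex_inj (inj_s j)).
have [g _ gK] := injF_bij (inj_s ord0).
pose P : {poly rat} := \poly_(k < n.+1) (m ((s ^+ k)%g ord0))%:~R.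
pose Q : {poly rat} := \sum_(k < n.+1) 'X^k.
have QE : Q = \poly_(k < n.+1) 1.
  by rewrite poly_def; apply: eq_bigr => k _; rewrite scale1r.
have coefQ (k : 'I_n.+1) : Q`_k = 1 by rewrite QE coef_poly ltn_ord.
have szQ : size Q = n.+1 by rewrite QE size_poly_eq // oner_neq0.
have irrQ : irreducible_poly Q := irreducible_geometric_sum pr_n.
have [/dvdpP[u DP]|] := boolP (Q %| P).
  have [c Du] : exists c, u = c%:P.
    exists u`_0; apply: size1_polyC; rewrite leqNgt; apply/negP => sz_u.
    have : (size P <= n.+1)%N by apply: size_poly.
    rewrite DP size_mul; first 1 last.
    - by rewrite -size_poly_gt0 ltnW.
    - by rewrite -size_poly_gt0 szQ.
    by rewrite szQ -subn1 addnS subn1 /= leqNgt -{1}[n.+1]add1n ltn_add2r sz_u.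
  have mc j : (m j)%:~R = c.
    have := congr1 (coefp (g j)) DP; rewrite /= Du mul_polyC coefZ coefQ mulr1.
    by rewrite coef_poly ltn_ord [(s ^+ g j)%g ord0]gK.
  by apply: (@intr_inj rat); rewrite !mc.
rewrite -irreducible_poly_coprime // => /Bezout_eq1_coprimepP[[w u] /= uwE].
pose A : 'M[R]_n.+1 := perm_mx s; pose v : 'cV[R]_n.+1 := \col_j l j.
pose e (f : {poly rat}) := horner_mx A (map_poly ratr f) *m v.
have eE (f : {poly rat}) j : (size f <= n.+1)%N ->
    e f j ord0 = \sum_(k < n.+1) ratr f`_k * l ((s ^+ k)%g j).
  move=> sz_f; rewrite /e horner_perm_mx size_map_poly.
  pose t k := (map_poly ratr f)`_k * v ((s ^+ k)%g j) ord0.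
  rewrite (big_ord_widen _ t sz_f) {}/t.
  rewrite big_mkcond /=; apply: eq_bigr => k _; rewrite mxE coef_map /=.
  by case: ltnP => // le_k; rewrite nth_default // raddf0 mul0r.
(* Since [j] is the image of [ord0] under [s ^+ g j], the entry at [j] is the relation at that
   element of [H]. *)
have eP : e P = 0.
  apply/colP=> j; rewrite (eE _ _ (size_poly _ _)) mxE -[j]gK.
  rewrite -[RHS](rel (s ^+ g j)%g) ?groupX //.
  rewrite -[RHS](sum_s (fun i1 => _ * l ((s ^+ g j)%g i1)) ord0).
  apply: eq_bigr => k _; rewrite coef_poly ltn_ord ratr_int -!permM.
  by rewrite -!expgD addnC.
have eQ j : e Q j ord0 = \sum_j l j.
  rewrite eE ?szQ // -(sum_s l j); apply: eq_bigr => k _.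
  by rewrite coefQ rmorph1 mul1r.
(* By Bezout [v] is the image under [w] of [e Q]; the latter is constant, so the matrix acts on it
   as 1 and [w] as its value at 1. *)
have vE j : v j ord0 = (map_poly ratr w).[1] * \sum_j l j.
  have {1}-> : v = horner_mx A (map_poly ratr w) *m e Q.
    rewrite /e mulmxA mulmxE -rmorphM /= -rmorphM.
    transitivity (e (w * Q + u * P)).
      by rewrite uwE /e rmorph1 rmorph1 mul1mx.
    rewrite /e !rmorphD /= mulmxDl [X in _ + X](_ : _ = 0) ?addr0 //.
    by rewrite !rmorphM /= -mulmxE -mulmxA -/(e P) eP mulmx0.
  rewrite horner_perm_mx horner_coef mulr_suml.
  by apply: eq_bigr => k _; rewrite eQ expr1n mulr1.
have lE j : l j = v j ord0 by rewrite mxE.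
by case/eqP: ne_l; rewrite !lE !vE.
Qed.

End PrimeDegree.

(** * Moduli, logarithms and arguments of complex numbers *)

Section ComplexModulus.
Variable R : realType.
Implicit Types (z : R[i]) (x : R).

Lemma normc_real x : 0 <= x -> Normc.normc x%:C = x.
Proof. by move=> x_ge0; rewrite /= expr0n addr0 sqrtr_sqr ger0_norm. Qed.

Lemma normc_ge0 z : 0 <= Normc.normc z.
Proof. by case: z => x y; rewrite sqrtr_ge0. Qed.

Lemma normc_gt0 z : z != 0 -> 0 < Normc.normc z.
Proof.
move=> nz_z; rewrite lt_neqAle normc_ge0 andbT eq_sym.
by apply: contra_neq nz_z => /Normc.eq0_normc.
Qed.

Lemma normc_prod (I : Type) (r : seq I) (f : I -> R[i]) :
  Normc.normc (\prod_(i <- r) f i) = \prod_(i <- r) Normc.normc (f i).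
Proof.
by apply: (big_morph _ (@Normc.normcM R)); rewrite -[RHS]normc_real.
Qed.

Lemma ln_normcXz z (m : int) : z != 0 ->
  ln (Normc.normc (z ^ m)) = m%:~R * ln (Normc.normc z).
Proof.
move=> nz_z; have lnX k : ln (Normc.normc (z ^+ k)) = k%:R * ln (Normc.normc z).
  elim: k => [|k IHk]; first by rewrite mul0r (normc_real ler01) ln1.
  rewrite exprS Normc.normcM lnM ?posrE ?normc_gt0 ?expf_neq0 // IHk.
  by rewrite -natr1 mulrDl mul1r addrC.
case: m => k; first exact: lnX.
rewrite NegzE -exprnN Normc.normcV lnV ?posrE ?normc_gt0 ?expf_neq0 // lnX.
by rewrite rmorphN mulNr.
Qed.

Lemma ln_normc_prod n (f : 'I_n -> R[i]) : (forall i, f i != 0) ->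
  ln (Normc.normc (\prod_i f i)) = \sum_i ln (Normc.normc (f i)).
Proof.
move=> nz_f; elim: n f nz_f => [|n IHn] f nz_f.
  by rewrite !big_ord0 (normc_real ler01) ln1.
rewrite !big_ord_recl Normc.normcM lnM ?posrE ?normc_gt0 ?IHn //.
by apply/prodf_neq0.
Qed.

(** The angle is the arc cosine of [x / r], with the sign of [y]. *)
Lemma polar_form z : z != 0 -> exists t : R, - pi < t <= pi /\
  z = (Normc.normc z)%:C * (cos t +i* sin t).
Proof.
move=> /normc_gt0; case: z => x y; set r := Normc.normc _ => r_gt0.
have r2 : r ^+ 2 = x ^+ 2 + y ^+ 2 by rewrite sqr_sqrtr // addr_ge0 ?sqr_ge0.
have nz_r : r != 0 by rewrite gt_eqF.
pose c := x / r; have c2 : 1 - c ^+ 2 = (y / r) ^+ 2.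
  rewrite !expr_div_n; apply: (@mulIf _ (r ^+ 2)); first by rewrite expf_neq0.
  by rewrite mulrBl mul1r !divfK ?expf_neq0 // r2 addrC addKr.
have c_bd : -1 <= c <= 1.
  rewrite -ler_norml -(@ler_pXn2r _ 2) ?nnegrE // expr1n -normrX.
  by rewrite ger0_norm ?sqr_ge0 // -subr_ge0 c2 sqr_ge0.
have sin_c : sin (acos c) = `|y| / r.
  by rewrite sin_acos // c2 sqrtr_sqr normrM normfV (gtr0_norm r_gt0).
have cos_c : cos (acos c) = c by apply: acosK; rewrite in_itv.
have eq_xy t : cos t = c -> sin t = y / r -> x +i* y = r%:C * (cos t +i* sin t).
  move=> -> ->; apply/eqP; rewrite eq_complex /= !mul0r subr0 addr0.
  by rewrite ![r * _]mulrC !divfK ?eqxx.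
have [y_ge0|y_lt0] := leP 0 y.
  exists (acos c); rewrite acos_lepi // andbT; split.
    by rewrite (lt_le_trans _ (acos_ge0 c_bd)) // oppr_lt0 pi_gt0.
  by apply: eq_xy => //; rewrite sin_c ger0_norm.
exists (- acos c); split.
  rewrite ltrN2 acos_ltpi /=.
    by rewrite (le_trans _ (pi_ge0 R)) // oppr_le0 acos_ge0.
  (* The bound [- pi] is strict: [y] is nonzero, so [c] is not -1. *)
  have [c_ge c_le] := andP c_bd; rewrite c_le andbT lt_neqAle c_ge andbT.
  have : (y / r) ^+ 2 != 0 by rewrite expf_neq0 // mulf_neq0 ?invr_eq0 // lt_eqF.
  by rewrite -c2; apply: contra_neq => <-; rewrite sqrrN expr1n subrr.
by apply: eq_xy; rewrite ?cosN // sinN sin_c ltr0_norm // mulNr opprK.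
Qed.

Lemma arg_polar z : z != 0 ->
  z = (Normc.normc z)%:C * (cos (arg z) +i* sin (arg z)).
Proof. by move=> /polar_form/(xgetPex 0)[]. Qed.

(** The default value 0 lies in the interval too, so [z] is arbitrary. *)
Lemma arg_itv z : - pi < arg z <= pi.
Proof.
rewrite /arg; case: xgetP => [t -> []|_] //.
by rewrite oppr_lt0 pi_gt0 pi_ge0.
Qed.

End ComplexModulus.

(** * The group of permutations preserving all relations *)

Section RelationStabilizer.
Variables (R : realType) (n : nat) (a : 'I_n.+1 -> R[i]).
Implicit Types (m : 'I_n.+1 -> int).

Definition relation_stab : {set 'S_n.+1} := finset (fun s : 'S_n.+1 =>
  `[< forall m, \prod_i a i ^ m i = 1 -> \prod_i a (s i) ^ m i = 1 >]).

Lemma relation_stabP (s : 'S_n.+1) : reflect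
  (forall m, \prod_i a i ^ m i = 1 -> \prod_i a (s i) ^ m i = 1)
  (s \in relation_stab).
Proof. by rewrite inE; apply: asboolP. Qed.

Lemma relation_stab_group_set : group_set relation_stab.
Proof.
apply/group_setP; split=> [|s t /relation_stabP ss /relation_stabP tt].
  by apply/relation_stabP=> m; under [in X in _ -> X]eq_bigr do rewrite perm1.
apply/relation_stabP=> m /ss.
(* Reindexing moves [s] from the conjugates to the exponents, which gives a relation that [t]
   preserves. *)
rewrite (reindex_inj (@perm_inj _ s^-1%g)) /=; under eq_bigr do rewrite permKV.
move=> /tt; rewrite (reindex_inj (@perm_inj _ s)) /= => rel.
by rewrite -[RHS]rel; apply: eq_bigr => i _; rewrite permM permK.
Qed.

Canonical relation_stab_group := Group relation_stab_group_set.

(** Injectivity of [phi] pulls the relation back to [L], where [g] preserves it. *)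
Lemma galois_perms_sub_stab p : galois_perms p a \subset relation_stab.
Proof.
apply/fintype.subsetP=> s; rewrite inE => /asboolP[L [phi [b [_ Da [g _ Dg]]]]].
have prodE (g' : {rmorphism L -> R[i]}) m :
    \prod_i g' (b i) ^ m i = g' (\prod_i b i ^ m i).
  by rewrite rmorph_prod; apply: eq_bigr => i _; rewrite fmorphXz.
apply/relation_stabP=> m; under eq_bigr do rewrite -Da.
rewrite prodE => /eqP; rewrite fmorph_eq1 => /eqP rel.
under eq_bigr do rewrite -Da -Dg.
transitivity (phi (g (\prod_i b i ^ m i))).
  by rewrite !rmorph_prod; apply: eq_bigr => i _; rewrite !fmorphXz.
by rewrite rel !rmorph1.
Qed.

End RelationStabilizer.

(** * Two-homogeneous permutation groups *)

Lemma sub_two_homogeneous n (G H : {set 'S_n}) :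
  G \subset H -> two_homogeneous G -> two_homogeneous H.
Proof.
move=> /fintype.subsetP sGH homG A B A2 B2.
by have [s /sGH Hs sA] := homG A B A2 B2; exists s.
Qed.

(* The transposition of the two elements of [B] corrects the parity of a
   permutation mapping [A] onto [B]. *)
Lemma Alt_two_homogeneous n : two_homogeneous ('Alt_('I_n))%g.
Proof.
move=> A B /eqP/cards2P[x [y [ne_xy ->]]] /eqP/cards2P[z [t [ne_zt ->]]].
have image2 (s : 'S_n) : [set s u | u in [set x; y]%SET]%SET = [set s x; s y]%SET.
  by rewrite imsetU1 imset_set1.
pose s := (tperm x z * tperm (tperm x z y) t)%g.
have sx : s x = z.
  rewrite permM tpermL tpermD //; last by rewrite eq_sym.
  by rewrite -[X in _ != X](tpermL x z) (inj_eq perm_inj) eq_sym.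
have sy : s y = t by rewrite permM tpermL.
have [odd_s|even_s] := boolP (odd_perm s).
  exists (s * tperm z t)%g; first by rewrite Alt_even odd_permM odd_s odd_tperm ne_zt.
  by rewrite image2 !(permM s) sx sy tpermL tpermR finset.setUC.
by exists s; rewrite ?Alt_even // image2 sx sy.
Qed.

Lemma two_homogeneous_pair n (H : {set 'S_n}) i j i' j' : two_homogeneous H ->
    i != j -> i' != j' ->
  exists2 s, s \in H & (s i = i' /\ s j = j') \/ (s i = j' /\ s j = i').
Proof.
move=> homH ne ne'; have [||s Hs] := homH [set i; j]%SET [set i'; j']%SET.
- by rewrite cards2 ne.
- by rewrite cards2 ne'.
rewrite imsetU1 imset_set1 => eq_s; exists s => //.
have : s i \in [set i'; j']%SET by rewrite -eq_s !inE eqxx.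
have : s j \in [set i'; j']%SET by rewrite -eq_s !inE eqxx orbT.
have ne_s : s i != s j by rewrite (inj_eq perm_inj).
rewrite !inE => /orP[]/eqP sj /orP[]/eqP si; move: ne_s; rewrite si sj ?eqxx //.
  by right.
by left.
Qed.

(** * Integrality of the minimal polynomial *)

(** Gauss's lemma: [q] factors over the integers as [p1 * r] with [p] a multiple of [p1]. As [p] and
    [q] are monic, the factor [c] is the leading coefficient of [r]. *)
Lemma minpoly_coef_int (R : realType) (alpha : R) (p : {poly rat}) k :
  algebraic_integer alpha -> is_minpoly p alpha%:C ->
  exists c : int, p`_k = c%:~R.
Proof.
move=> [q mon_q qa] [mon_p dv_p].
have /dvdpP_rat_int[p1 [c nz_c Dp] [r Dq]] : p %| map_poly intr q.
  rewrite -dv_p -map_poly_comp.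
  have -> : map_poly (ratr \o intr) q = map_poly (real_complex R) (map_poly intr q).
    by rewrite -map_poly_comp; apply: eq_map_poly => j /=; rewrite ratr_int rmorph_int.
  exact: rmorph_root.
have lead1 : lead_coef p1 * lead_coef r = 1 by rewrite -lead_coefM -Dq (monicP mon_q).
have Dc : c = (lead_coef r)%:~R.
  have : c * (lead_coef p1)%:~R = 1.
    have := monicP mon_p; rewrite Dp lead_coefZ lead_coef_map_inj //.
    exact: intr_inj.
  by move/(congr1 ( *%R^~ (lead_coef r)%:~R)); rewrite -mulrA -intrM lead1 mulr1 mul1r.
by exists (lead_coef r * p1`_k); rewrite Dp coefZ coef_map Dc intrM.
Qed.

(** * Triviality of the relations and injectivity of the indexation map *)

Section TrivialRelations.
Variables (R : realType) (alpha : R) (n : nat) (p : {poly rat}) (a : 'I_n.+1 -> R[i]).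
Hypotheses (perron_alpha : perron alpha) (conj_a : conjugates_of alpha p a).

Let l i := ln (Normc.normc (a i)).
Let H := relation_stab_group a.

Lemma conjugates_irreducible : irreducible_poly p.
Proof.
have [[mon_p dv_p] _ _] := conj_a.
exact: minpoly_irreducible (monic_neq0 mon_p) dv_p.
Qed.

Lemma perron_gt0 : 0 < alpha.
Proof. by have [_ a_gt1 _] := perron_alpha; apply: lt_trans a_gt1. Qed.

Lemma conjugates_neq0 i : a i != 0.
Proof.
have [_ Dp a0] := conj_a; apply: (conj_neq0 conjugates_irreducible Dp (i := ord0)).
by rewrite a0 fmorph_eq0 gt_eqF // perron_gt0.
Qed.

Lemma conjugates_conjugate i : Defs.conjugate alpha%:C (a i).
Proof.
by have [min_p Dp _] := conj_a; exists p; last exact: conj_root Dp i.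
Qed.

Lemma conjugates_neq i : i != ord0 -> a i != alpha%:C.
Proof.
have [_ Dp <-] := conj_a.
by apply: contra_neq => /(conj_inj conjugates_irreducible Dp).
Qed.

Lemma ln_conj0 : l ord0 = ln alpha.
Proof. by have [_ _ a0] := conj_a; rewrite /l a0 normc_real // ltW // perron_gt0. Qed.

Lemma ln_conj_lt i : i != ord0 -> l i < l ord0.
Proof.
move=> /conjugates_neq ne_i; have [_ _ dom] := perron_alpha.
rewrite ln_conj0 ltr_ln ?posrE ?perron_gt0 ?normc_gt0 ?conjugates_neq0 //.
exact: dom (conjugates_conjugate i) ne_i.
Qed.

Lemma stab_trans j : exists2 s, s \in H & s ord0 = j.
Proof.
have [_ Dp _] := conj_a.
have [s sj rel_s] := conj_perm conjugates_irreducible Dp j (conjugates_neq0 ord0).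
by exists s => //; apply/relation_stabP.
Qed.

(** Taking moduli loses the arguments, but leaves one real relation for each element of [H]. *)
Lemma orbit_relation_ln (m : 'I_n.+1 -> int) :
  \prod_i a i ^ m i = 1 -> orbit_relation l H m.
Proof.
move=> rel s /relation_stabP/(_ m rel) /(congr1 (fun z => ln (Normc.normc z))).
rewrite ln_normc_prod => [|i]; last by rewrite expfz_neq0 ?conjugates_neq0.
rewrite (normc_real ler01) ln1 => rel_s; rewrite -[RHS]rel_s.
by apply: eq_bigr => i _; rewrite ln_normcXz ?conjugates_neq0.
Qed.

(* The product of the conjugates is, up to sign, the constant coefficient of
   [p], a nonzero integer. *)
Lemma sum_ln_conj_ge0 : 0 <= \sum_i l i.
Proof.
have [int_alpha _ _] := perron_alpha; have [min_p Dp _] := conj_a.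
have [c Dc] := minpoly_coef_int 0 int_alpha min_p.
have nz_a := conjugates_neq0.
rewrite -ln_normc_prod //; apply: ln_ge0.
have := congr1 (fun f : {poly R[i]} => Normc.normc f.[0]) Dp.
rewrite horner_coef0 coef_map Dc /= ratr_int horner_prod !normc_prod.
have -> : \prod_i Normc.normc ('X - (a i)%:P).[0] = \prod_i Normc.normc (a i).
  apply: eq_bigr => i _; rewrite hornerXsubC sub0r -mulN1r Normc.normcM.
  by rewrite -[X in X * _](_ : 1 = _) ?mul1r //= sqrrN expr1n oppr0 expr0n addr0 sqrtr1.
have -> : c%:~R = (c%:~R : R)%:C by rewrite rmorph_int.
move=> Dn; have nz_n : \prod_i Normc.normc (a i) != 0.
  by apply/prodf_neq0 => i _; rewrite gt_eqF ?normc_gt0.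
rewrite -Dn /= expr0n addr0 sqrtr_sqr -intr_norm ler1z -gtz0_ge1 normr_gt0.
by apply: contraNneq nz_n => c0; rewrite -Dn c0 normc_real.
Qed.

Lemma trivial_relationsP :
    [\/ pisot alpha, prime n.+1 | two_homogeneous (galois_perms p a)] ->
  trivial_relations a.
Proof.
move=> cases m /= rel; exists (m ord0 ord0) => //.
have relm := orbit_relation_ln rel; have trH := stab_trans.
suffices const_m i : m ord0 i = m ord0 ord0.
  by apply/rowP=> i; rewrite !mxE mulr1 const_m.
have [-> //|ne_i] := eqVneq i ord0.
(* In the last two cases the dominance of [alpha] enters as the non-constancy of [l]. *)
have ne_l : l i != l ord0 by rewrite lt_eqF ?ln_conj_lt.
case: cases => [[_ _ dom]|pr_n|homG].
- apply: (dominant_relation_const trH) relm => [j ne_j|].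
  + rewrite -ln1 ltr_ln ?posrE ?normc_gt0 ?conjugates_neq0 //.
    exact: dom (conjugates_conjugate j) (conjugates_neq ne_j).
  + exact: sum_ln_conj_ge0.
- exact: (prime_relation_const pr_n trH) ne_l relm.
apply: (two_homogeneous_relation_const trH _ i ne_l relm) => j k j' k'.
apply: two_homogeneous_pair.
exact: sub_two_homogeneous (galois_perms_sub_stab a p) homG.
Qed.

Lemma iota_map_Omega0 : set_fun setT (Omega0 alpha) (iota_map alpha a).
Proof.
have [_ a_gt1 _] := perron_alpha.
move=> kappa _; rewrite /Omega0 /=; set z := \prod_(_ < _) _.
have /andP[lb ub] := arg_itv z.
by rewrite -mulNr ltr_pM2r ?ler_pM2r ?invr_gt0 ?ln_gt0 // lb ub.
Qed.

(* [s_kappa] determines [z / alpha ^ |kappa|], [z] being the product of the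
   [a j ^ kappa j]: the real part gives the modulus and the imaginary part the
   argument. *)
Lemma iota_map_inj : trivial_relations a -> injective (iota_map alpha a).
Proof.
move=> triv k k'; rewrite /iota_map.
set z := \prod_(_ < _) _; set z' := \prod_(_ < _) _.
set K := (\sum_(_ < _) k _); set K' := (\sum_(_ < _) k' _).
have [_ a_gt1 _] := perron_alpha; have L_gt0 := ln_gt0 a_gt1.
have nz_a := conjugates_neq0.
have nz_z : z != 0 by apply/prodf_neq0 => j _; rewrite expf_neq0.
have nz_z' : z' != 0 by apply/prodf_neq0 => j _; rewrite expf_neq0.
have nz_L : ln alpha != 0 by rewrite gt_eqF.
move=> [eq_re /(mulIf (invr_neq0 nz_L)) eq_arg].
have eq_norm : Normc.normc z * alpha ^+ K' = Normc.normc z' * alpha ^+ K.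
  have a_gt0 := perron_gt0.
  apply: ln_inj; rewrite ?posrE ?mulr_gt0 ?normc_gt0 ?exprn_gt0 //.
  rewrite !lnM ?posrE ?normc_gt0 ?exprn_gt0 // !lnXn //.
  rewrite -(mulr_natl (ln alpha) K) -(mulr_natl (ln alpha) K').
  move/(congr1 ( *%R^~ (ln alpha))): eq_re; rewrite !mulrDl !divfK //.
  by rewrite -/K -/K' => eq_re; lra.
have eq_z : z * alpha%:C ^+ K' = z' * alpha%:C ^+ K.
  rewrite (arg_polar nz_z) (arg_polar nz_z') eq_arg mulrAC [RHS]mulrAC.
  by rewrite -!rmorphXn -!rmorphM /= eq_norm.
(* The relation expressed by [eq_z]; its exponent at [alpha] makes the total exponent zero. *)
pose m : 'rV[int]_n.+1 := \row_i
  if unlift ord0 i is Some j then (k j)%:Z - (k' j)%:Z else K'%:Z - K%:Z.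
have XzB x (u v : nat) : x != 0 -> x ^ (u%:Z - v%:Z) = x ^+ u / x ^+ v :> R[i].
  by move=> nz_x; rewrite expfzDr // exprnN.
have nz_alpha : alpha%:C != 0 by have [_ _ <-] := conj_a.
have /triv[c _ Dc] : relation_module a m.
  have [_ _ a0] := conj_a.
  rewrite /relation_module /= big_ord_recl mxE unlift_none XzB // a0.
  under eq_bigr do rewrite mxE liftK XzB //.
  rewrite prodf_div -/z -/z' mulf_div [alpha%:C ^+ K' * z]mulrC eq_z.
  by rewrite [alpha%:C ^+ K * z']mulrC divff // mulf_neq0 ?expf_neq0.
have mE i : m ord0 i = c by rewrite -Dc !mxE mulr1.
have kE j : (k j)%:Z - (k' j)%:Z = c by rewrite -(mE (lift ord0 j)) mxE liftK.
have KE : K'%:Z - K%:Z = c by rewrite -(mE ord0) mxE unlift_none.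
(* Together with [KE] this gives [c *+ n.+1 = 0]. *)
have : K%:Z - K'%:Z = c *+ n.
  rewrite /K /K' -!natz !natr_sum -sumrB -[n in RHS]card_ord -sumr_const.
  by apply: eq_bigr => j _; rewrite !natz kE.
rewrite -opprB KE => /eqP; rewrite eq_sym -addr_eq0 -mulrSr mulrn_eq0 /= => /eqP c0.
by apply/ffunP => j; apply/eqP; rewrite -eqz_nat -subr_eq0 kE c0.
Qed.

End TrivialRelations.

Theorem theorem5p6 (R : realType) (alpha : R) (n : nat) (p : {poly rat})
    (a : 'I_n.+1 -> R[i]) :
  perron alpha ->
  conjugates_of alpha p a ->
  [\/ pisot alpha,
      prime n.+1,
      galois_perms p a = ('Sym_('I_n.+1))%g \/ galois_perms p a = ('Alt_('I_n.+1))%g |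
      two_homogeneous (galois_perms p a)] ->
  trivial_relations a /\
  set_fun setT (Omega0 alpha) (iota_map alpha a) /\
  injective (iota_map alpha a).
Proof.
move=> perron_alpha conj_a cases.
have triv : trivial_relations a.
  apply: trivial_relationsP perron_alpha conj_a _.
  case: cases => [pis|pr|sym|hom]; [exact: Or31|exact: Or32| |exact: Or33].
  (* The alternating group is contained in either group. *)
  apply: Or33; apply: sub_two_homogeneous (@Alt_two_homogeneous _).
  by case: sym => -> //; rewrite finset.subsetT.
split=> //; split; first exact: iota_map_Omega0 perron_alpha.
exact: iota_map_inj perron_alpha conj_a triv.
Qed.
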